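(* If $\mathcal F$ is a superrigid class of graphs, then so is $\mathrm{co}(\mathcal F)$.
   Context: Graphs are finite, simple and undirected, with at least one vertex, considered up to isomorphism (so $G=H$ means isomorphic); a class of graphs is a set of isomorphism classes of graphs. $\mathrm{co}(\mathcal F)$, the class of $\mathcal F$-cographs, is the smallest class of graphs containing $\mathcal F$ and stable under finite disjoint unions and complement. A magic unitary with coefficients in a nonzero unital $C^*$-algebra $X$ is a square matrix whose entries are self-adjoint projections of $X$ with every row and column summing to $1_X$. Two graphs $G$ and $H$ with equally many vertices are quantum isomorphic if there is a magic unitary $U$, with coefficients in some nonzero unital $C^*$-algebra, rows indexed by $V(H)$ and columns by $V(G)$, with $U\,\mathrm{Adj}(G)=\mathrm{Adj}(H)\,U$ ($\mathrm{Adj}$ = adjacency matrix). A class $\mathcal F$ is superrigid if, for any two graphs $G$ and $H$ with $G\in\mathcal F$ and $G$ quantum isomorphic to $H$ (where $H$ is an arbitrary graph), one has $G=H$. *)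

(* Defs.v *)
From HB Require Import structures.
From mathcomp Require Import all_boot all_order all_algebra.
From mathcomp Require Import complex.
From mathcomp Require Import reals.

Set Implicit Arguments.
Unset Strict Implicit.
Unset Printing Implicit Defensive.

Import Order.TTheory GRing.Theory Num.Theory.

Local Open Scope ring_scope.
Local Open Scope complex_scope.

Record sgraph := SGraph {
  vertex :> finType;
  edge : rel vertex;
  edge_sym : symmetric edge;
  edge_irrefl : irreflexive edge;
  vertex_gt0 : (0 < #|vertex|)%N }.

Definition graph_iso (G H : sgraph) : Prop :=
  exists2 f : G -> H, bijective f & {mono f : x y / edge x y}.

Section Complement.
Variable G : sgraph.

Definition compl_edge : rel G := fun x y => (x != y) && ~~ edge x y.

Lemma compl_edge_sym : symmetric compl_edge.
Proof. by move=> x y; rewrite /compl_edge eq_sym edge_sym. Qed.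

Lemma compl_edge_irrefl : irreflexive compl_edge.
Proof. by move=> x; rewrite /compl_edge eqxx. Qed.

Definition compl : sgraph :=
  SGraph compl_edge_sym compl_edge_irrefl (vertex_gt0 G).

End Complement.

(* Graphs being nonempty, only nonempty families have a disjoint union. *)
Section DisjointUnion.
Variables (n : nat) (G : 'I_n.+1 -> sgraph).

Definition dunion_vertex : finType := {i : 'I_n.+1 & G i}.

Definition dunion_edge : rel dunion_vertex := fun u v =>
  (tag u == tag v) && edge (tagged u) (tagged_as u v).

Lemma dunion_edge_sym : symmetric dunion_edge.
Proof.
move=> [i x] [j y]; rewrite /dunion_edge /=.
have [eq_ij|//] := eqVneq i j; move: y; rewrite -{j}eq_ij => y /=.
by rewrite !tagged_asE edge_sym.
Qed.

Lemma dunion_edge_irrefl : irreflexive dunion_edge.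
Proof. by case=> i x; rewrite /dunion_edge tagged_asE edge_irrefl andbF. Qed.

Lemma dunion_vertex_gt0 : (0 < #|dunion_vertex|)%N.
Proof.
have /card_gt0P[x _] := vertex_gt0 (G ord0).
by apply/card_gt0P; exists (Tagged (fun i => vertex (G i)) x).
Qed.

Definition dunion : sgraph :=
  SGraph dunion_edge_sym dunion_edge_irrefl dunion_vertex_gt0.

End DisjointUnion.

(* A set of isomorphism classes of graphs. *)
Record graph_class := GraphClass {
  in_class :> sgraph -> Prop;
  in_class_iso : forall G H, graph_iso G H -> in_class G -> in_class H }.

Inductive co_spec (F : graph_class) : sgraph -> Prop :=
| co_base G : F G -> co_spec F G
| co_compl G : co_spec F G -> co_spec F (compl G)
| co_dunion n (G : 'I_n.+1 -> sgraph) :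
    (forall i, co_spec F (G i)) -> co_spec F (dunion G)
| co_iso G H : graph_iso G H -> co_spec F G -> co_spec F H.

Definition co (F : graph_class) : graph_class := GraphClass (@co_iso F).

(* [algType] carriers are nontrivial rings: 1 != 0.  The norm and completeness
   are fields of the mixin because Hierarchy Builder admits no join of
   [completeNormedModType] with a ring structure, the normed rings of MathComp
   all being [numDomainType]s. *)
HB.mixin Record isCStarAlgebra (R : realType) A & GRing.Algebra R[i] A := {
  cnorm : A -> R;
  star : A -> A;
  ler_cnormD : forall x y, cnorm (x + y) <= cnorm x + cnorm y;
  cnormZ : forall (a : R[i]) x, cnorm (a *: x) = Normc.normc a * cnorm x;
  cnorm0_eq0 : forall x, cnorm x = 0 -> x = 0;
  ler_cnormM : forall x y, cnorm (x * y) <= cnorm x * cnorm y;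
  cnorm_complete : forall u : nat -> A,
    (forall e : R, 0 < e -> exists N : nat,
       forall m n : nat, (N <= m)%N -> (N <= n)%N -> cnorm (u m - u n) < e) ->
    exists l : A, forall e : R, 0 < e -> exists N : nat,
       forall n : nat, (N <= n)%N -> cnorm (u n - l) < e;
  starD : forall x y, star (x + y) = star x + star y;
  starZ : forall (a : R[i]) x, star (a *: x) = (a^*)%C *: star x;
  starM : forall x y, star (x * y) = star y * star x;
  starK : involutive star;
  cnorm_starM : forall x, cnorm (star x * x) = cnorm x ^+ 2 }.

#[short(type="cstarAlgType")]
HB.structure Definition CStarAlgebra (R : realType) :=
  {A of GRing.Algebra R[i] A & isCStarAlgebra R A}.

Definition projection (R : realType) (X : cstarAlgType R) (p : X) : Prop :=
  star p = p /\ p * p = p.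

(* Rectangular, to allow rows and columns indexed by the vertices of two
   different graphs; [quantum_iso] asks separately that they be equally many. *)
Definition magic_unitary (R : realType) (X : cstarAlgType R) (m n : nat)
    (U : 'M[X]_(m, n)) : Prop :=
  [/\ forall i j, projection (U i j),
      forall i, \sum_j U i j = 1
    & forall j, \sum_i U i j = 1].

Definition adj (X : nzRingType) (G : sgraph) : 'M[X]_#|G| :=
  \matrix_(i, j) (edge (enum_val i) (enum_val j))%:R.

Definition quantum_iso (R : realType) (G H : sgraph) : Prop :=
  #|G| = #|H| /\
  exists (X : cstarAlgType R) (U : 'M[X]_(#|H|, #|G|)),
    magic_unitary U /\ U *m adj X G = adj X H *m U.

Definition superrigid (R : realType) (F : graph_class) : Prop :=
  forall G H : sgraph, F G -> quantum_iso R G H -> graph_iso G H.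

(* Main.v *)
(* Call G rigid if every graph quantum isomorphic to G is isomorphic to G.  Rigidity
   is shown to be preserved by complements and disjoint unions, which gives the
   theorem by induction on the construction of a cograph.

   Let u be a magic unitary intertwining G and H.  Since projections summing to 1
   in a C*-algebra are pairwise orthogonal, u x y * u x' y' = 0 as soon as exactly
   one of xx', yy' is an edge.  Hence for a component C of G the sum of u x y over
   y in C depends only on the component D of x, and symmetrically.  If u x y <> 0,
   with C and D the components of y and x, comparing the two double sums over D
   and C gives |C| = |D| and a common nonzero value p; the block of u at (D, C) is
   a magic unitary with coefficients in the corner p X p, so that C and D are
   quantum isomorphic.

   If all components of G are rigid, u is therefore supported on pairs of vertices
   lying in isomorphic components, and summing u over the vertices in components
   of a given isomorphism type shows that G and H have equally many of them.  So G
   is rigid.  Conversely, a component C of a rigid graph is rigid: if C is quantum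
   isomorphic to L, substituting L for C in G does not change G up to isomorphism,
   and counting vertices in components isomorphic to C gives C = L.  Thus a graph
   is rigid if and only if its components are, whence the case of disjoint unions. *)
Require Import Defs.
From HB Require Import structures.
From mathcomp Require Import all_boot all_order all_algebra.
From mathcomp Require Import complex boolp reals ring lra zify.

Set Implicit Arguments.
Unset Strict Implicit.
Unset Printing Implicit Defensive.

Import Order.TTheory GRing.Theory Num.Theory.

Local Open Scope ring_scope.
Local Open Scope complex_scope.

(** * C*-algebras *)

Section CStarNorm.
Variables (R : realType) (X : cstarAlgType R).
Implicit Types x y c p q : X.

Lemma cnorm0 : cnorm (0 : X) = 0.
Proof. by rewrite -(scale0r (0 : X)) cnormZ Normc.normc0 mul0r. Qed.

Lemma cnormN x : cnorm (- x) = cnorm x.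
Proof. by rewrite -scaleN1r cnormZ normcN Normc.normc1 mul1r. Qed.

Lemma cnorm_ge0 x : 0 <= cnorm x.
Proof.
have := ler_cnormD x (- x); rewrite subrr cnorm0 cnormN; lra.
Qed.

Lemma cnorm_sum (I : Type) (r : seq I) (P : pred I) (f : I -> X) :
  cnorm (\sum_(i <- r | P i) f i) <= \sum_(i <- r | P i) cnorm (f i).
Proof.
elim/big_ind2: _ => [|x a y b xa yb|//]; first by rewrite cnorm0.
exact: le_trans (ler_cnormD _ _) (lerD xa yb).
Qed.

Lemma star0 : star (0 : X) = 0.
Proof. by rewrite -(scale0r (0 : X)) starZ rmorph0 !scale0r. Qed.

Lemma star1 : star (1 : X) = 1.
Proof. by have := starM (star 1) (1 : X); rewrite mulr1 starK mulr1. Qed.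

Lemma starN x : star (- x) = - star x.
Proof. by apply/eqP; rewrite -addr_eq0 -starD addNr star0. Qed.

Lemma star_sum (I : Type) (r : seq I) (P : pred I) (f : I -> X) :
  star (\sum_(i <- r | P i) f i) = \sum_(i <- r | P i) star (f i).
Proof. exact: (big_morph _ (@starD R X) star0). Qed.

Lemma starM_eq0 x : star x * x = 0 -> x = 0.
Proof.
move=> xx0; apply/cnorm0_eq0/eqP.
by rewrite -sqrf_eq0 -cnorm_starM xx0 cnorm0.
Qed.

Lemma cnorm_projection p : projection p -> cnorm p <= 1.
Proof.
case=> ps pp; have := cnorm_starM p; rewrite ps pp => /eqP.
rewrite -subr_eq0 expr2 -{1}[cnorm p]mulr1 -mulrBr mulf_eq0 subr_eq0 => /orP[]/eqP; lra.
Qed.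

Lemma projection1 : projection (1 : X).
Proof. by split; rewrite ?star1 ?mulr1. Qed.

Lemma projectionC p : projection p -> projection (1 - p).
Proof.
case=> ps pp; split; first by rewrite starD starN star1 ps.
by rewrite mulrBl mul1r mulrBr mulr1 pp subrr subr0.
Qed.

Lemma cnorm1 : cnorm (1 : X) = 1.
Proof.
apply/le_anti/andP; split; first exact: cnorm_projection projection1.
have := ler_cnormM (1 : X) 1; rewrite mulr1.
have n1 : cnorm (1 : X) != 0.
  by apply/eqP => /cnorm0_eq0/eqP; rewrite oner_eq0.
by rewrite -{1}[cnorm 1]mulr1 ler_pM2l // lt_def n1 cnorm_ge0.
Qed.

Lemma cnormX_le1 x n : cnorm x <= 1 -> cnorm (x ^+ n) <= 1.
Proof.
move=> x1; elim: n => [|n IHn]; first by rewrite cnorm1.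
rewrite exprS; apply: le_trans (ler_cnormM _ _) _.
by rewrite -[leRHS](mulr1 1) ler_pM ?cnorm_ge0.
Qed.

Lemma cnormX_le x n : cnorm (x ^+ n) <= cnorm x ^+ n.
Proof.
elim: n => [|n IHn]; first by rewrite cnorm1.
rewrite !exprS; apply: le_trans (ler_cnormM _ _) _.
by rewrite ler_wpM2l ?cnorm_ge0.
Qed.

Lemma normc_real (a : R) : Normc.normc a%:C = `|a|.
Proof. by rewrite /Normc.normc /= expr0n addr0 sqrtr_sqr. Qed.

Lemma cnormZr (a : R) x : 0 <= a -> cnorm (a%:C *: x) = a * cnorm x.
Proof. by move=> a0; rewrite cnormZ normc_real ger0_norm. Qed.

(** Complex scalars force characteristic zero. This is how equalities between sums of projections
    become equalities of cardinals. *)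
Lemma mulrn_inj x m n : x != 0 -> x *+ m = x *+ n -> m = n.
Proof.
move=> x0 /eqP; rewrite -[x *+ m]scaler_nat -[x *+ n]scaler_nat.
rewrite -subr_eq0 -scalerBl scaler_eq0 (negPf x0) orbF.
by rewrite subr_eq0 eqr_nat => /eqP.
Qed.

End CStarNorm.

(** * Extremality of the unit in the unit ball *)

Lemma expn3_le_fact j : (3 < j)%N -> (3 ^ j <= 4 * j`!)%N.
Proof.
elim: j => [//|j IHj]; rewrite ltnS leq_eqVlt => /orP[/eqP <-//|j3].
by rewrite expnS factS mulnCA leq_mul ?IHj //; lia.
Qed.

(** The left side is at most $(ny)^j/j! = (3/2)^j/j!$, and $3^j \le 4\, j!$. *)
Lemma binomial_term_le (R : realFieldType) (n j : nat) (y : R) :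
  0 <= y -> n%:R * y = 3 / 2 -> (3 < j)%N -> 'C(n, j)%:R * y ^+ j <= 4 / 2 ^+ j.
Proof.
move=> y0 ny j3.
have ffact_le : (n ^_ j <= n ^ j)%N.
  elim: {j3}j => [//|j IHj]; rewrite ffactnSr expnSr leq_mul //; lia.
have h : ('C(n, j) * 3 ^ j <= 4 * n ^ j)%N.
  apply: leq_trans (leq_mul (leqnn _) (expn3_le_fact j3)) _.
  by rewrite mulnCA bin_ffact leq_mul.
have e3 : 0 < 3 ^+ j :> R by rewrite exprn_gt0.
have e2 : 0 < 2 ^+ j :> R by rewrite exprn_gt0.
rewrite -(ler_pM2r e3); apply: (@le_trans _ _ (4 * (n%:R * y) ^+ j)).
  rewrite mulrAC exprMn mulrA ler_wpM2r ?exprn_ge0 //.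
  by rewrite -!natrX -!natrM ler_nat.
by rewrite ny expr_div_n -mulrA [2 ^- j * _]mulrC.
Qed.

Lemma geometric_tail_le (R : realFieldType) (N : nat) :
  \sum_(j < N) (if (j < 5)%N then 0 else 4 / 2 ^+ j) <= 1 / 4 :> R.
Proof.
(* As $8/2^5 = 1/4$, the [maxn] makes the closed form vanish as long as no nonzero term has been
   added. *)
suff h : \sum_(j < N) (if (j < 5)%N then 0 else 4 / 2 ^+ j)
  = 1 / 4 - 8 / 2 ^+ maxn N 5 :> R.
  by rewrite h gerBl divr_ge0 // exprn_ge0.
elim: N => [|N IHN]; first by rewrite big_ord0 /=; field.
rewrite big_ord_recr /= IHN; case: ltnP => N5.
  by rewrite (maxn_idPr N5) addr0.
rewrite (maxn_idPl (leqW N5)) exprS.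
have : 2 ^+ N != 0 :> R by rewrite expf_neq0 // pnatr_eq0.
by move=> ?; field.
Qed.

Section Vertex.
Variables (R : realType) (X : cstarAlgType R).
Implicit Types c : X.

Lemma normcX (z : R[i]) n : Normc.normc (z ^+ n) = Normc.normc z ^+ n.
Proof. by elim: n => [|n IHn]; rewrite ?Normc.normc1 // !exprS Normc.normcM IHn. Qed.

Lemma normci : Normc.normc ('i : R[i]) = 1.
Proof. by rewrite /Normc.normc /= expr0n expr1n add0r sqrtr1. Qed.

(** Since $(1+c)^2 + (1-c)^2 = 2(1+c^2)$, the hypotheses bound $1+c^2$. For self-adjoint $c$ this is
    $x^*x$ with $x = 1 \pm ic$, so the C*-identity settles the two imaginary roots of unity. *)
Lemma cnorm1iX c : star c = c -> cnorm (1 + c) <= 1 -> cnorm (1 - c) <= 1 ->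
  forall k : nat, (k < 4)%N -> cnorm (1 + ('i ^+ k : R[i]) *: c) <= 1.
Proof.
move=> cs cD cB.
have cc : cnorm (1 + c * c) <= 1.
  have e : 2%:C *: (1 + c * c) = (1 + c) * (1 + c) + (1 - c) * (1 - c).
    rewrite !mulrDl !mulrDr !mul1r !mulr1 !mulNr !mulrN opprK.
    rewrite addrACA [1 + c + _]addrACA [c + _ + _]addrACA subrr addr0 add0r.
    by rewrite rmorph_nat scaler_nat mulr2n addrACA.
  have := ler_cnormD ((1 + c) * (1 + c)) ((1 - c) * (1 - c)).
  have := le_trans (ler_cnormM _ _) (ler_pM (cnorm_ge0 _) (cnorm_ge0 _) cD cD).
  have := le_trans (ler_cnormM _ _) (ler_pM (cnorm_ge0 _) (cnorm_ge0 _) cB cB).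
  rewrite -e cnormZr //; lra.
have ci (e : R[i]) : e ^+ 2 = -1 -> e^* = - e -> cnorm (1 + e *: c) <= 1.
  move=> e2 es; rewrite -(@ler_pXn2r _ 2) ?nnegrE ?cnorm_ge0 //.
  rewrite expr1n -cnorm_starM starD star1 starZ cs es.
  rewrite mulrDl !mulrDr !mul1r mulr1 -scalerAl -scalerAr scalerA mulNr -expr2 e2 opprK scale1r.
  by rewrite scaleNr addrA addrK.
have i_conj : 'i^* = - 'i :> R[i].
  by apply/eqP; rewrite eq_complex /= oppr0 eqxx /= eqxx.
have i2 : 'i ^+ 2 = -1 :> R[i] by rewrite sqr_i.
case=> [|[|[|[|//]]]] _.
- by rewrite expr0 scale1r.
- by apply: ci; rewrite ?i2 ?i_conj.
- by rewrite i2 scaleN1r.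
- by rewrite exprS i2 mulrN1; apply: ci; [rewrite sqrrN | rewrite rmorphN -i_conj].
Qed.

(** Orthogonality of the characters of $\mathbb Z/4$: the shift by 3 stands for multiplication by
    $i^{-k}$, so among the exponents below 5 only $j = 1$ survives. *)
Lemma sum_expi (j : nat) :
  let s := \sum_(k < 4) ('i : R[i]) ^+ (k * (j + 3)) in
  [/\ j = 1%N -> s = 4, j != 1%N -> (j < 5)%N -> s = 0 & Normc.normc s <= 4].
Proof.
have i2 : 'i ^+ 2 = -1 :> R[i] by rewrite sqr_i.
have i4 : 'i ^+ 4 = 1 :> R[i] by rewrite -[4%N]/(2 * 2)%N exprM i2 sqrrN expr1n.
split.
- move=> ->; rewrite (eq_bigr (fun=> 1)) ?sumr_const ?card_ord // => k _.
  by rewrite mulnC exprM i4 expr1n.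
- move=> j1 j5; set z := ('i : R[i]) ^+ (j + 3).
  have -> : \sum_(k < 4) 'i ^+ (k * (j + 3)) = (z ^+ 2 + 1) * (z + 1).
    under eq_bigr => k _ do rewrite mulnC exprM -/z.
    by rewrite !big_ord_recr big_ord0 /=; ring.
  apply/eqP; rewrite mulf_eq0 /z -exprM mulnC exprM i2 !addr_eq0.
  move: j1 j5; case: j @z => [|[|[|[|[|//]]]]] _ //= _ _.
  + by rewrite -signr_odd expr1 eqxx.
  + by rewrite -[(2 + 3)%N]/5%N -signr_odd expr1 eqxx.
  + rewrite -[(3 + 3)%N]/(2 * 3)%N [X in _ || (X == _)]exprM i2.
    by rewrite -[in X in _ || X]signr_odd expr1 eqxx orbT.
  + by rewrite -[(4 + 3)%N]/7%N -signr_odd expr1 eqxx.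
apply: (@le_trans _ _ (\sum_(k < 4) Normc.normc (('i : R[i]) ^+ (k * (j + 3))))).
  elim/big_ind2: _ => [|x a y b xa yb|//]; first by rewrite Normc.normc0.
  exact: le_trans (le_normcD _ _) (lerD xa yb).
rewrite (eq_bigr (fun=> 1)) ?sumr_const ?card_ord // => k _.
by rewrite normcX normci expr1n.
Qed.

(* Averaging [(1 + w t c) ^+ n] against the inverses of the fourth roots of
   unity [w] isolates [n t c] up to terms of order 5; taking [n t cnorm c = 3/2]
   makes these smaller than 1/4. *)
Lemma cnorm1_extreme c :
  star c = c -> cnorm (1 + c) <= 1 -> cnorm (1 - c) <= 1 -> c = 0.
Proof.
move=> cs cD cB; apply: cnorm0_eq0; apply: contrapT => /eqP c_neq0.
have c_gt0 : 0 < cnorm c by rewrite lt_def c_neq0 cnorm_ge0.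
(* [n] is taken large enough for the factor [t] with $n t \|c\| = 3/2$ to be at most 1. *)
pose n := (Num.bound (3 / 2 / cnorm c)).+1.
have n_gt0 : 0 < n%:R :> R by rewrite ltr0n.
have n_large : 3 / 2 < n%:R * cnorm c.
  rewrite -ltr_pdivrMr //; apply: lt_trans (archi_boundP _) _.
    by rewrite !divr_ge0 // ltW.
  by rewrite ltr_nat.
have nc_gt0 : 0 < n%:R * cnorm c by rewrite mulr_gt0.
have [t [t_ge0 t_le1 nt]] : exists t, [/\ 0 <= t, t <= 1 & n%:R * (t * cnorm c) = 3 / 2].
  exists (3 / 2 / (n%:R * cnorm c)); split.
  - by rewrite !divr_ge0 // ltW.
  - by rewrite ler_pdivrMr // mul1r ltW.
  - by rewrite mulrCA divfK ?gt_eqF.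
pose E (k : nat) : X := (1 + (('i ^+ k : R[i]) * t%:C) *: c) ^+ n.
have E_le1 (k : 'I_4) : cnorm (E k) <= 1.
  apply: cnormX_le1.
  (* A convex combination of 1 and $1 + i^k c$, both in the unit ball. *)
  have -> : 1 + ('i ^+ k * t%:C) *: c
      = (1 - t)%:C *: (1 : X) + t%:C *: (1 + 'i ^+ k *: c).
    rewrite scalerDr scalerA [t%:C * _]mulrC addrA -scalerDl -rmorphD /=.
    by rewrite subrK scale1r.
  apply: le_trans (ler_cnormD _ _) _; rewrite !cnormZr ?subr_ge0 // cnorm1 mulr1.
  have := cnorm1iX cs cD cB (ltn_ord k) => h.
  by have := ler_wpM2l t_ge0 h; lra.
pose s (j : nat) : R[i] := \sum_(k < 4) 'i ^+ (k * (j + 3)).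
have E_sum : \sum_(k < 4) ('i ^+ (k * 3) : R[i]) *: E k
  = \sum_(j < n.+1) ('C(n, j)%:R * t ^+ j)%:C *: (s j *: c ^+ j).
  under eq_bigr => k _.
    rewrite /E exprDn_comm; last exact/commr_sym/commr1.
    rewrite scaler_sumr; under eq_bigr => j _.
      rewrite expr1n mul1r exprZn -scaler_nat !scalerA.
      rewrite (_ : _ * _ = ('C(n, j)%:R * t ^+ j)%:C * 'i ^+ (k * (j + 3))); last first.
        have -> : ('C(n, j)%:R * t ^+ j)%:C = 'C(n, j)%:R * t%:C ^+ j.
          by rewrite -rmorphXn -(rmorph_nat (real_complex R)) -rmorphM.
        by rewrite exprMn -exprM mulnDr exprD; ring.
      over.
    over.
  rewrite exchange_big; apply: eq_bigr => j _ /=.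
  by rewrite -scaler_suml -mulr_sumr scalerA.
have : cnorm (\sum_(k < 4) ('i ^+ (k * 3) : R[i]) *: E k) <= 4.
  apply: le_trans (cnorm_sum _ _ _) _.
  rewrite -[leRHS](_ : \sum_(k < 4) 1 = 4); last by rewrite sumr_const card_ord.
  by apply: ler_sum => k _; rewrite cnormZ normcX normci expr1n mul1r.
have one_lt : (1 < n.+1)%N by [].
rewrite E_sum (bigD1 (Ordinal one_lt)) //=; set x := (X in X + _); set y := (X in _ + X).
move=> xy_le.
have x_norm : cnorm x = 4 * (n%:R * (t * cnorm c)).
  have [/(_ erefl) s1 _ _] := sum_expi 1.
  rewrite /x bin1 !expr1 /s s1 cnormZr ?mulr_ge0 ?ler0n //.
  rewrite -[4](rmorph_nat (real_complex R)) cnormZr ?ler0n //; ring.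
have y_le : cnorm y <= 4 * \sum_(j < n.+1) (if (j < 5)%N then 0 else 4 / 2 ^+ j).
  rewrite mulr_sumr [leRHS](bigD1 (Ordinal one_lt)) //= mulr0 add0r.
  apply: le_trans (cnorm_sum _ _ _) (ler_sum _ _) => j.
  have [_ s0 s_le] := sum_expi j.
  rewrite -val_eqE /= => j1; case: ltnP => j5.
    by rewrite /s s0 // scale0r scaler0 cnorm0 mulr0.
  rewrite cnormZr ?mulr_ge0 ?ler0n ?exprn_ge0 // cnormZ.
  have jb := binomial_term_le (mulr_ge0 t_ge0 (ltW c_gt0)) nt (ltnW j5).
  rewrite mulrCA; apply: ler_pM => //.
  - by case: (s j) => *; rewrite /Normc.normc sqrtr_ge0.
  - by rewrite !mulr_ge0 ?ler0n ?exprn_ge0 ?cnorm_ge0.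
  apply: le_trans jb; rewrite exprMn mulrA; apply: ler_wpM2l (cnormX_le _ _).
  by rewrite mulr_ge0 ?ler0n ?exprn_ge0.
(* The term [x] of index 1 has norm $4 \cdot 3/2 = 6$, whereas $\|x+y\| \le 4$ and $\|y\| \le 1$. *)
have := geometric_tail_le R n.+1; have := ler_cnormD (x + y) (- y).
rewrite addrK cnormN x_norm nt; lra.
Qed.

End Vertex.

(** * Corners of a C*-algebra *)

Record nzprojection (R : realType) (X : cstarAlgType R) := NzProjection {
  nzproj :> X;
  nzproj_projection : projection nzproj;
  nzproj_neq0 : nzproj != 0 }.

(** The subalgebra $pXp$, whose unit is [p]; bundling [p] with a proof that it is nonzero makes the
    corner a nontrivial ring. *)
Record corner (R : realType) (X : cstarAlgType R) (p : nzprojection X) := Corner {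
  corner_val :> X;
  corner_valP : nzproj p * corner_val * nzproj p == corner_val }.

Section Corner.
Variables (R : realType) (X : cstarAlgType R) (p : nzprojection X).
Local Notation Y := (corner p).
Local Notation P := (nzproj p).

HB.instance Definition _ := [isSub for @corner_val R X p].
HB.instance Definition _ := [Choice of Y by <:].

Let pp : P * P = P. Proof. by case: (nzproj_projection p). Qed.
Let ps : star P = P. Proof. by case: (nzproj_projection p). Qed.

Definition in_corner (x : X) := P * x * P == x.

Lemma corner_compress_subproof (x : X) : in_corner (P * x * P).
Proof. by rewrite /in_corner !mulrA pp -mulrA pp. Qed.
Definition compress (x : X) : Y := Corner (corner_compress_subproof x).

Lemma corner_mull (x : Y) : P * corner_val x = corner_val x.
Proof. by rewrite -(eqP (corner_valP x)) !mulrA pp. Qed.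

Lemma corner_mulr (x : Y) : corner_val x * P = corner_val x.
Proof. by rewrite -(eqP (corner_valP x)) -mulrA pp. Qed.

Lemma in_cornerP (x : X) : P * x = x -> x * P = x -> in_corner x.
Proof. by rewrite /in_corner => -> ->. Qed.

Lemma corner_0_subproof : in_corner 0.
Proof. by rewrite /in_corner mulr0 mul0r. Qed.
Lemma corner_opp_subproof (x : Y) : in_corner (- corner_val x).
Proof. by apply: in_cornerP; rewrite ?mulrN ?mulNr ?corner_mull ?corner_mulr. Qed.
Lemma corner_add_subproof (x y : Y) : in_corner (corner_val x + corner_val y).
Proof.
by apply: in_cornerP; rewrite ?mulrDl ?mulrDr ?corner_mull ?corner_mulr.
Qed.
Lemma corner_mul_subproof (x y : Y) : in_corner (corner_val x * corner_val y).
Proof. by apply: in_cornerP; rewrite ?mulrA ?corner_mull // -mulrA corner_mulr. Qed.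
Lemma corner_1_subproof : in_corner P.
Proof. exact: in_cornerP. Qed.
Lemma corner_scale_subproof (a : R[i]) (x : Y) : in_corner (a *: corner_val x).
Proof.
by apply: in_cornerP; rewrite -?scalerAl -?scalerAr ?corner_mull ?corner_mulr.
Qed.
Lemma corner_star_subproof (x : Y) : in_corner (star (corner_val x)).
Proof. by apply: in_cornerP; rewrite -{1}ps -starM ?corner_mull ?corner_mulr. Qed.

Let zero : Y := Corner corner_0_subproof.
Let opp (x : Y) : Y := Corner (corner_opp_subproof x).
Let add (x y : Y) : Y := Corner (corner_add_subproof x y).
Let mul (x y : Y) : Y := Corner (corner_mul_subproof x y).
Let one : Y := Corner corner_1_subproof.
Let scale (a : R[i]) (x : Y) : Y := Corner (corner_scale_subproof a x).
Let cstar (x : Y) : Y := Corner (corner_star_subproof x).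

Fact corner_addA : associative add.
Proof. by move=> x y z; apply: val_inj; rewrite /= addrA. Qed.
Fact corner_addC : commutative add.
Proof. by move=> x y; apply: val_inj; rewrite /= addrC. Qed.
Fact corner_add0 : left_id zero add.
Proof. by move=> x; apply: val_inj; rewrite /= add0r. Qed.
Fact corner_addN : left_inverse zero opp add.
Proof. by move=> x; apply: val_inj; rewrite /= addNr. Qed.

HB.instance Definition _ := GRing.isZmodule.Build Y
  corner_addA corner_addC corner_add0 corner_addN.

Fact corner_mulA : associative mul.
Proof. by move=> x y z; apply: val_inj; rewrite /= mulrA. Qed.
Fact corner_mul1l : left_id one mul.
Proof. by move=> x; apply: val_inj; rewrite /= corner_mull. Qed.
Fact corner_mul1r : right_id one mul.
Proof. by move=> x; apply: val_inj; rewrite /= corner_mulr. Qed.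
Fact corner_mulDl : left_distributive mul add.
Proof. by move=> x y z; apply: val_inj; rewrite /= mulrDl. Qed.
Fact corner_mulDr : right_distributive mul add.
Proof. by move=> x y z; apply: val_inj; rewrite /= mulrDr. Qed.
Fact corner_1_neq0 : one != 0 :> Y.
Proof. by rewrite -val_eqE /= nzproj_neq0. Qed.

HB.instance Definition _ := GRing.Zmodule_isNzRing.Build Y
  corner_mulA corner_mul1l corner_mul1r corner_mulDl corner_mulDr corner_1_neq0.

Fact corner_scaleA a b (x : Y) : scale a (scale b x) = scale (a * b) x.
Proof. by apply: val_inj; rewrite /= scalerA. Qed.
Fact corner_scale1 : left_id 1 scale.
Proof. by move=> x; apply: val_inj; rewrite /= scale1r. Qed.
Fact corner_scaleDr : right_distributive scale +%R.
Proof. by move=> a x y; apply: val_inj; rewrite /= scalerDr. Qed.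
Fact corner_scaleDl (x : Y) : {morph scale^~ x : a b / a + b}.
Proof. by move=> a b; apply: val_inj; rewrite /= scalerDl. Qed.

HB.instance Definition _ := GRing.Zmodule_isLmodule.Build R[i] Y
  corner_scaleA corner_scale1 corner_scaleDr corner_scaleDl.

Fact corner_scaleAl (a : R[i]) (x y : Y) : a *: (x * y) = (a *: x) * y.
Proof. by apply: val_inj; rewrite /= scalerAl. Qed.
HB.instance Definition _ := GRing.Lmodule_isLalgebra.Build R[i] Y corner_scaleAl.

Fact corner_scaleAr (a : R[i]) (x y : Y) : a *: (x * y) = x * (a *: y).
Proof. by apply: val_inj; rewrite /= scalerAr. Qed.
HB.instance Definition _ := GRing.Lalgebra_isAlgebra.Build R[i] Y corner_scaleAr.

Let norm (x : Y) : R := cnorm (corner_val x).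

(** Compression does not increase the norm and fixes the corner, so compressing the limit taken in
    [X] again gives a limit. *)
Fact corner_complete (u : nat -> Y) :
  (forall e : R, 0 < e -> exists N : nat,
     forall m n : nat, (N <= m)%N -> (N <= n)%N -> norm (u m - u n) < e) ->
  exists l : Y, forall e : R, 0 < e -> exists N : nat,
     forall n : nat, (N <= n)%N -> norm (u n - l) < e.
Proof.
move=> u_cauchy; have [l ul] := @cnorm_complete R X (fun n => corner_val (u n)) u_cauchy.
exists (compress l) => e e_gt0; have [N uN] := ul e e_gt0.
exists N => n Nn; rewrite /norm /= -(eqP (corner_valP (u n))) -mulrBl -mulrBr.
apply: le_lt_trans (uN n Nn).
have p1 : cnorm P <= 1 := cnorm_projection (nzproj_projection p).
apply: le_trans (ler_cnormM _ _) _; rewrite -[leRHS]mulr1.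
apply: ler_pM; rewrite ?cnorm_ge0 //.
by apply: le_trans (ler_cnormM _ _) _; rewrite -[leRHS]mul1r ler_pM ?cnorm_ge0.
Qed.

Fact corner_normD (x y : Y) : norm (x + y) <= norm x + norm y.
Proof. exact: ler_cnormD. Qed.
Fact corner_normZ (a : R[i]) (x : Y) : norm (a *: x) = Normc.normc a * norm x.
Proof. exact: cnormZ. Qed.
Fact corner_norm0_eq0 (x : Y) : norm x = 0 -> x = 0.
Proof. by move=> /cnorm0_eq0 x0; apply: val_inj. Qed.
Fact corner_normM (x y : Y) : norm (x * y) <= norm x * norm y.
Proof. exact: ler_cnormM. Qed.
Fact corner_starD (x y : Y) : cstar (x + y) = cstar x + cstar y.
Proof. by apply: val_inj; exact: starD. Qed.
Fact corner_starZ (a : R[i]) (x : Y) : cstar (a *: x) = (a^*)%C *: cstar x.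
Proof. by apply: val_inj; exact: starZ. Qed.
Fact corner_starM (x y : Y) : cstar (x * y) = cstar y * cstar x.
Proof. by apply: val_inj; exact: starM. Qed.
Fact corner_starK : involutive cstar.
Proof. by move=> x; apply: val_inj; exact: starK. Qed.
Fact corner_norm_starM (x : Y) : norm (cstar x * x) = norm x ^+ 2.
Proof. exact: cnorm_starM. Qed.

HB.instance Definition _ := isCStarAlgebra.Build R Y
  corner_normD corner_normZ corner_norm0_eq0 corner_normM corner_complete
  corner_starD corner_starZ corner_starM corner_starK corner_norm_starM.

Lemma corner_val_sum (I : Type) (r : seq I) (P : pred I) (f : I -> Y) :
  corner_val (\sum_(i <- r | P i) f i) = \sum_(i <- r | P i) corner_val (f i).
Proof. exact: (big_morph (@corner_val R X p)). Qed.

End Corner.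

(** * Orthogonality of projections summing to 1 *)

Section Orthogonality.
Variables (R : realType) (X : cstarAlgType R).

(* Writing [p = q j], the elements [a k = p * q k * p] of the corner of [p] satisfy
   [cnorm (1 - a k) <= 1] and sum to 0 over [k != j].  Hence [cnorm (m + a i) <= m],
   where [m] is the number of terms, and [cnorm1_extreme] applies to [a i / m]. *)
Lemma projection_sum1_orth (I : finType) (q : I -> X) :
  (forall i, projection (q i)) -> \sum_i q i = 1 ->
  forall i j, i != j -> q i * q j = 0.
Proof.
move=> qP q1 i j ij.
have [qj0|qj_neq0] := eqVneq (q j) 0; first by rewrite qj0 mulr0.
pose p : nzprojection X := NzProjection (qP j) qj_neq0.
have [ps pp] := qP j.
pose a k : corner p := compress p (q k).
have as_ k : star (a k) = a k.
  by apply: val_inj; rewrite /= !starM ps (qP k).1 mulrA.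
have a_le k : cnorm (1 - a k) <= 1.
  have -> : 1 - a k = compress p (1 - q k).
    by apply: val_inj; rewrite /= mulrBr mulrBl mulr1 pp.
  have q'1 := cnorm_projection (projectionC (qP k)).
  have p1 := cnorm_projection (qP j).
  apply: le_trans (ler_cnormM _ _) _; rewrite -[leRHS]mulr1.
  apply: ler_pM; rewrite ?cnorm_ge0 //.
  by apply: le_trans (ler_cnormM _ _) _; rewrite -[leRHS]mul1r ler_pM ?cnorm_ge0.
have a0 : \sum_(k | k != j) a k = 0.
  apply: val_inj; rewrite -[LHS]/(corner_val _) corner_val_sum /= -mulr_suml -mulr_sumr.
  move: q1; rewrite (bigD1 j) //= => /(canRL (addKr _)) ->.
  by rewrite mulrDr mulrN mulr1 pp addNr mul0r.
pose m := #|[pred k | k != j]|.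
have m_gt0 : (0 < m)%N by apply/card_gt0P; exists i.
have m_pos : 0 < m%:R :> R by rewrite ltr0n.
have sumD : cnorm (m%:R + a i) <= m%:R.
  (* Here [a i] is minus the sum of the other [a k], so the left side is 1 plus [m - 1]
     contractions. *)
  have -> : m%:R + a i = 1 + \sum_(k | (k != j) && (k != i)) (1 - a k).
    move: a0; rewrite (bigD1 i) //= => /(canRL (addrK _)); rewrite sub0r => ->.
    rewrite sumrB addrA; congr (_ - _).
    by rewrite -sumr_const (bigD1 i).
  apply: le_trans (ler_cnormD _ _) _; rewrite cnorm1.
  apply: le_trans (lerD (lexx _) (cnorm_sum _ _ _)) _.
  apply: le_trans (lerD (lexx _) (ler_sum _ (fun k _ => a_le k))) _.
  by rewrite -sumr_const [leRHS](bigD1 i).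
suff ai0 : a i = 0.
  (* [a i] is $x^*x$ for $x = q_i q_j$. *)
  apply: starM_eq0; rewrite starM ps (qP i).1 mulrA -[_ * q i * q i]mulrA (qP i).2.
  by have <- : corner_val (a i) = 0 by rewrite ai0.
pose c := (m%:R^-1)%:C *: a i.
suff c0 : c = 0.
  by move/eqP: c0; rewrite scaler_eq0 => /orP[/eqP[/eqP]|/eqP//]; rewrite invr_eq0 gt_eqF.
apply: cnorm1_extreme.
- by rewrite starZ as_ conjc_real.
- have -> : 1 + c = (m%:R^-1)%:C *: (m%:R + a i).
    rewrite scalerDr; congr (_ + _).
    rewrite -scaler_nat scalerA -(rmorph_nat (real_complex R)) -rmorphM /=.
    by rewrite mulVf ?gt_eqF // scale1r.
  by rewrite cnormZr ?invr_ge0 ?ler0n // -ler_pdivlMl ?invr_gt0 // invrK mulr1.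
- have minv_le1 : m%:R^-1 <= 1 :> R by rewrite invf_le1 // ler1n.
  have -> : 1 - c = (1 - m%:R^-1)%:C *: 1 + (m%:R^-1)%:C *: (1 - a i).
    by rewrite scalerBr addrA -scalerDl -rmorphD /= subrK scale1r.
  apply: le_trans (ler_cnormD _ _) _.
  rewrite !cnormZr ?subr_ge0 ?invr_ge0 ?ler0n // cnorm1 mulr1.
  have := ler_wpM2l (ltW (_ : 0 < m%:R^-1)) (a_le i); rewrite invr_gt0 => /(_ m_pos); lra.
Qed.

End Orthogonality.

(** * Magic unitaries and components *)

Section QuantumIso.
Variable R : realType.

Definition magic_intertwiner (X : cstarAlgType R) (G H : sgraph)
    (u : H -> G -> X) : Prop :=
  [/\ forall x y, projection (u x y),
      forall x, \sum_y u x y = 1,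
      forall y, \sum_x u x y = 1
    & forall x y, \sum_y' u x y' * (edge y' y)%:R
                = \sum_x' (edge x x')%:R * u x' y].

(** Indexing by vertices removes the enumerations. The equality of cardinals is recovered by summing
    all entries by rows and by columns, which gives $|H| \cdot 1 = |G| \cdot 1$. *)
Lemma quantum_isoP (G H : sgraph) :
  quantum_iso R G H <->
  exists (X : cstarAlgType R) (u : H -> G -> X), magic_intertwiner u.
Proof.
split=> [[_ [X [U [[proj row col] UA]]]] | [X [u [proj row col inter]]]].
  exists X, (fun x y => U (enum_rank x) (enum_rank y)); split.
  - by [].
  - move=> x; rewrite -(row (enum_rank x)) [RHS](reindex enum_rank) //.
    exact/onW_bij/enum_rank_bij.
  - move=> y; rewrite -(col (enum_rank y)) [RHS](reindex enum_rank) //.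
    exact/onW_bij/enum_rank_bij.
  - move=> x y; have /matrixP/(_ (enum_rank x) (enum_rank y)) := UA.
    rewrite !mxE (reindex enum_rank); last exact/onW_bij/enum_rank_bij.
    rewrite [RHS](reindex enum_rank); last exact/onW_bij/enum_rank_bij.
    under eq_bigr do rewrite mxE !enum_rankK.
    by under [RHS]eq_bigr do rewrite mxE !enum_rankK.
split.
  apply: (mulrn_inj (oner_neq0 X)).
  have : \sum_y \sum_x u x y = \sum_x \sum_y u x y by exact: exchange_big.
  under eq_bigr do rewrite col.
  by under [RHS]eq_bigr do rewrite row; rewrite !sumr_const.
exists X, (\matrix_(i, j) u (enum_val i) (enum_val j)); split; first split.
- by move=> i j; rewrite mxE.
- move=> i; rewrite -(row (enum_val i)) [RHS](reindex _ (onW_bij _ (@enum_val_bij G))) /=.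
  by apply: eq_bigr => j _; rewrite mxE.
- move=> j; rewrite -(col (enum_val j)) [RHS](reindex _ (onW_bij _ (@enum_val_bij H))) /=.
  by apply: eq_bigr => i _; rewrite mxE.
apply/matrixP => i j; have := inter (enum_val i) (enum_val j).
rewrite (reindex _ (onW_bij _ (@enum_val_bij G))).
rewrite [RHS](reindex _ (onW_bij _ (@enum_val_bij H))) /=.
rewrite !mxE => h.
under eq_bigr do rewrite !mxE.
by under [RHS]eq_bigr do rewrite !mxE.
Qed.

(** Adjacency matrices are symmetric with central entries, so the transposed relation is the
    original one with its sides exchanged. Facts about rows thereby apply to columns. *)
Lemma magic_intertwiner_tr (X : cstarAlgType R) (G H : sgraph) (u : H -> G -> X) :
  magic_intertwiner u -> magic_intertwiner (fun y x => u x y).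
Proof.
case=> proj row col inter; split=> // y x.
under eq_bigr do rewrite commr_nat edge_sym.
by rewrite -inter; apply: eq_bigr => y' _; rewrite commr_nat edge_sym.
Qed.

Section MagicIntertwiner.
Variables (X : cstarAlgType R) (G H : sgraph) (u : H -> G -> X).
Hypothesis uP : magic_intertwiner u.

Lemma intertwiner_orth x y y' : y != y' -> u x y * u x y' = 0.
Proof. by case: uP => proj row _ _; apply: projection_sum1_orth. Qed.

Lemma intertwiner_orth_tr x x' y : x != x' -> u x y * u x' y = 0.
Proof.
case: uP => proj _ col _.
exact: (@projection_sum1_orth _ _ _ (fun x => u x y)).
Qed.

(** Multiply the [(x, y')] entry of the intertwining relation by [u x y] on the left and [u x' y']
    on the right. Orthogonality along row [x] and column [y'] leaves the product weighted by
    [edge y y'] on one side and by [edge x x'] on the other. *)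
Lemma intertwiner_edge x x' y y' :
  edge x x' != edge y y' -> u x y * u x' y' = 0.
Proof.
case: uP => proj _ _ inter ne.
have sq a b : u a b * u a b = u a b by case: (proj a b).
have := congr1 (fun z => u x y * z * u x' y') (inter x y').
rewrite mulr_sumr mulr_suml (bigD1 y) //= big1 => [|z zy]; last first.
  by rewrite !mulrA intertwiner_orth ?mul0r // eq_sym.
rewrite mulr_sumr mulr_suml (bigD1 x') //= big1 => [|z zx]; last first.
  by rewrite -!mulrA intertwiner_orth_tr ?mulr0.
rewrite !addr0 !mulrA sq -[RHS]mulrA sq.
by move: ne; case: (edge x x') (edge y y') => [] []; rewrite ?(mulr0, mul0r, mulr1).
Qed.

(** Both sums equal their product: there, either factor may be extended to all of [G], where it is
    1, because each added term pairs the edge between [x] and [x'] with a non-edge across the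
    boundary of [C]. *)
Lemma sum_intertwiner_edge (C : {pred G}) x x' :
  closed (@edge G) C -> edge x x' -> \sum_(y in C) u x y = \sum_(y in C) u x' y.
Proof.
case: uP => proj row _ _ Ccl exx'.
transitivity ((\sum_(y in C) u x y) * (\sum_(y in C) u x' y)).
  rewrite mulr_suml; apply: eq_bigr => y yC.
  rewrite -[LHS]mulr1 -(row x') mulr_sumr [LHS](bigID [in C]) /= -mulr_sumr.
  rewrite [X in _ + X]big1 ?addr0 // => y' y'C.
  apply: intertwiner_edge; rewrite exx'; apply: contra y'C => /eqP/esym eyy'.
  by rewrite -(Ccl _ _ eyy').
rewrite mulr_sumr; apply: eq_bigr => y yC.
rewrite -[RHS]mul1r -(row x) [RHS]mulr_suml [RHS](bigID [in C]) /= -mulr_suml.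
rewrite [X in _ + X]big1 ?addr0 // => y' y'C.
apply: intertwiner_edge; rewrite exx'; apply: contra y'C => /eqP/esym eyy'.
by rewrite (Ccl _ _ eyy').
Qed.

Lemma sum_intertwiner_connect (C : {pred G}) x x' :
  closed (@edge G) C -> connect (@edge H) x x' ->
  \sum_(y in C) u x y = \sum_(y in C) u x' y.
Proof.
move=> Ccl /(closed_connect (a := [pred z | \sum_(y in C) u x y == \sum_(y in C) u z y])).
rewrite !inE eqxx => /(_ _)/esym/eqP; apply => a b ab.
by rewrite !inE (sum_intertwiner_edge Ccl ab).
Qed.

Lemma intertwiner_mul_sum (C : {pred G}) x y :
  y \in C -> u x y * (\sum_(y' in C) u x y') = u x y.
Proof.
move=> yC; rewrite mulr_sumr (bigD1 y) //= big1 ?addr0; first by case: uP => /(_ x y)[].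
by move=> y' /andP[_ y'y]; rewrite intertwiner_orth // eq_sym.
Qed.

Lemma projection_sum_intertwiner (C : {pred G}) x :
  projection (\sum_(y in C) u x y).
Proof.
split.
  by rewrite star_sum; apply: eq_bigr => y _; case: uP => /(_ x y)[].
by rewrite {1}mulr_suml; apply: eq_bigr => y yC; rewrite intertwiner_mul_sum.
Qed.

End MagicIntertwiner.
End QuantumIso.

(** * Induced subgraphs and connected components *)

Section Induced.
Variables (G : sgraph) (A : {set G}) (a : G).
Hypothesis aA : a \in A.

Definition induced_vertex : finType := {x : G | x \in A}.
Definition induced_edge : rel induced_vertex := fun x y => edge (val x) (val y).
Lemma induced_edge_sym : symmetric induced_edge.
Proof. by move=> x y; apply: edge_sym. Qed.
Lemma induced_edge_irrefl : irreflexive induced_edge.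
Proof. by move=> x; apply: edge_irrefl. Qed.
Lemma induced_vertex_gt0 : (0 < #|induced_vertex|)%N.
Proof. by apply/card_gt0P; exists (exist _ a aA). Qed.
Definition induced : sgraph :=
  SGraph induced_edge_sym induced_edge_irrefl induced_vertex_gt0.
End Induced.

Definition component_set (G : sgraph) (x : G) : {set G} :=
  [set z | connect (@edge G) x z].

Lemma mem_component (G : sgraph) (x : G) : x \in component_set x.
Proof. by rewrite inE connect0. Qed.

Lemma component_closed (G : sgraph) (x : G) : closed (@edge G) (component_set x).
Proof.
move=> y z yz; rewrite !inE.
exact: (connect_closed (sym_connect_sym (@edge_sym G)) x yz).
Qed.

Definition component (G : sgraph) (x : G) : sgraph := induced (mem_component x).

Section QuantumComponent.
Variables (R : realType) (X : cstarAlgType R).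

(** Squaring gives $m^2 p = n^2 q = nm\, p$, hence $m = n$, and the common nonzero multiple
    cancels. *)
Lemma projection_mulrn (p q : X) m n :
  projection p -> projection q -> p != 0 -> (0 < m)%N -> p *+ m = q *+ n -> p = q.
Proof.
move=> [_ pp] [_ qq] p0 m0 pq.
have mn : m = n.
  apply/eqP; rewrite -(eqn_pmul2l m0); apply/eqP/(mulrn_inj p0).
  have : (p *+ m) * (p *+ m) = (q *+ n) * (q *+ n) by rewrite pq.
  by rewrite !mulrnAl !mulrnAr pp qq -pq -!mulrnA [(m * n)%N]mulnC.
subst n; apply/eqP; rewrite -subr_eq0; move/eqP: pq.
rewrite -subr_eq0 -mulrnBl -[X in X == 0]scaler_nat scaler_eq0 pnatr_eq0 => /orP[/eqP m_eq0|//].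
by rewrite m_eq0 in m0.
Qed.

Lemma corner_val_mulb (p : nzprojection X) (x : corner p) (b : bool) :
  corner_val (x * b%:R) = corner_val x * b%:R.
Proof. by case: b; rewrite ?(mulr1, mulr0). Qed.

Lemma corner_val_bmul (p : nzprojection X) (x : corner p) (b : bool) :
  corner_val (b%:R * x) = b%:R * corner_val x.
Proof. by case: b; rewrite ?(mul1r, mul0r). Qed.

Lemma quantum_iso_component (G H : sgraph) (u : H -> G -> X) x y :
  magic_intertwiner u -> u x y != 0 ->
  quantum_iso R (component y) (component x).
Proof.
move=> uP uxy0; have uP' := magic_intertwiner_tr uP.
have [proj row col inter] := uP.
set C := component_set y; set D := component_set x.
have Ccl : closed (@edge G) C := component_closed y.
have Dcl : closed (@edge H) D := component_closed x.
pose P := \sum_(y' in C) u x y'.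
have PE x' : x' \in D -> \sum_(y' in C) u x' y' = P.
  by rewrite inE => xx'; rewrite /P (sum_intertwiner_connect uP Ccl xx').
have P_proj : projection P := projection_sum_intertwiner uP C x.
have P0 : P != 0.
  apply: contra uxy0 => /eqP P0.
  by rewrite -(intertwiner_mul_sum uP (C := C)) ?mem_component // -/P P0 mulr0.
pose Q := \sum_(x' in D) u x' y.
have QE y' : y' \in C -> \sum_(x' in D) u x' y' = Q.
  by rewrite inE => yy'; rewrite /Q (sum_intertwiner_connect uP' Dcl yy').
(* The double sum of [u] over [D] and [C] is $|D| P$ by rows and $|C| Q$ by columns. *)
have PQ : P = Q.
  apply: (@projection_mulrn P Q #|D| #|C|) => //.
  - exact: (projection_sum_intertwiner uP' D y).
  - by apply/card_gt0P; exists x; exact: mem_component.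
  rewrite -!sumr_const -(eq_bigr _ PE) -(eq_bigr _ QE); exact: exchange_big.
(* Each entry of the block lies below [P], hence in the corner, where compression leaves it
   unchanged. *)
have uPr x' y' : x' \in D -> y' \in C -> u x' y' * P = u x' y'.
  by move=> x'D y'C; rewrite -(PE x') ?intertwiner_mul_sum.
have uPl x' y' : x' \in D -> y' \in C -> P * u x' y' = u x' y'.
  move=> x'D y'C; have := congr1 (@star R X) (uPr _ _ x'D y'C).
  by rewrite starM P_proj.1 (proj x' y').1.
pose p := NzProjection P_proj P0.
pose v (x' : component x) (y' : component y) : corner p :=
  compress p (u (val x') (val y')).
have vE x' y' : corner_val (v x' y') = u (val x') (val y').
  by rewrite /= uPl ?uPr ?(valP x') ?(valP y').
apply/quantum_isoP; exists (corner p), v; split.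
- move=> x' y'; have [us uu] := proj (val x') (val y').
  split; apply: val_inj.
    by rewrite -[LHS]/(star (corner_val (v x' y'))) -[RHS]/(corner_val _) vE.
  rewrite -[LHS]/(corner_val (v x' y') * corner_val (v x' y')).
  by rewrite -[RHS]/(corner_val _) vE.
- move=> x'; apply: val_inj; rewrite -[LHS]/(corner_val _) corner_val_sum.
  under eq_bigr do rewrite vE.
  by rewrite -(big_sub [in C] (fun y' => u (val x') y')) PE ?(valP x').
- move=> y'; apply: val_inj; rewrite -[LHS]/(corner_val _) corner_val_sum.
  under eq_bigr do rewrite vE.
  by rewrite -(big_sub [in D] (fun x' => u x' (val y'))) QE ?(valP y').
move=> x' y'; apply: val_inj.
rewrite -[LHS]/(corner_val _) -[RHS]/(corner_val _) !corner_val_sum.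
under eq_bigr do rewrite corner_val_mulb vE.
under [RHS]eq_bigr do rewrite corner_val_bmul vE.
rewrite -(big_sub [in C] (fun z => u (val x') z * (edge z (val y'))%:R)).
rewrite -(big_sub [in D] (fun z => (edge (val x') z)%:R * u z (val y'))).
(* Terms outside the components carry a zero adjacency coefficient, so both sums extend to all
   vertices and the relation for [u] applies. *)
rewrite [LHS]big_mkcond [RHS]big_mkcond; etransitivity; [|etransitivity].
2: exact: inter (val x') (val y').
- apply: eq_bigr => z _; case: ifPn => // zC.
  case: (boolP (edge z (val y'))) => [/Ccl zy|]; last by rewrite mulr0.
  by rewrite zy (valP y') in zC.
apply: eq_bigr => z _; case: ifPn => // zD.
case: (boolP (edge (val x') z)) => [/Dcl xz|]; last by rewrite mul0r.
by rewrite -xz (valP x') in zD.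
Qed.

End QuantumComponent.

(** * Isomorphisms between sets of vertices *)

(** An isomorphism of induced subgraphs, carried by a total function of which only the restriction
    to [A] matters. This allows empty sets, and gluing of maps without subtypes. *)
Definition iso_on (G H : sgraph) (A : {set G}) (B : {set H}) : Prop :=
  exists f : G -> H, [/\ {in A &, injective f}, f @: A = B
    & {in A &, {mono f : x y / edge x y}}].

Section IsoOn.
Implicit Types G H K : sgraph.

Lemma iso_on_sym G H (A : {set G}) (B : {set H}) : iso_on A B -> iso_on B A.
Proof.
move=> [f [f_inj fAB f_mono]]; have /card_gt0P[a0 _] := vertex_gt0 G.
(* The default [a0] is taken only outside [f @: A]. *)
pose g z := odflt a0 [pick x in A | f x == z].
have gK : {in A, cancel f g}.
  move=> x xA; rewrite /g; case: pickP => [x' /andP[x'A /eqP]|/(_ x)] /=.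
    exact: f_inj.
  by rewrite xA eqxx.
exists g; split.
- by rewrite -fAB => _ _ /imsetP[x xA ->] /imsetP[y yA ->]; rewrite !gK // => ->.
- rewrite -fAB -imset_comp -[RHS]imset_id; apply: eq_in_imset => x xA.
  exact: gK.
by rewrite -fAB => _ _ /imsetP[x xA ->] /imsetP[y yA ->]; rewrite !gK // f_mono.
Qed.

Lemma iso_on_trans G H K (A : {set G}) (B : {set H}) (C : {set K}) :
  iso_on A B -> iso_on B C -> iso_on A C.
Proof.
move=> [f [f_inj fAB f_mono]] [g [g_inj gBC g_mono]].
have fB x : x \in A -> f x \in B by move=> xA; rewrite -fAB imset_f.
exists (g \o f); split.
- by move=> x y xA yA /g_inj /f_inj; apply; rewrite ?fB.
- by rewrite imset_comp fAB.
- by move=> x y xA yA; rewrite /= g_mono ?fB // f_mono.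
Qed.

Lemma iso_on_card G H (A : {set G}) (B : {set H}) : iso_on A B -> #|A| = #|B|.
Proof. by move=> [f [f_inj <- _]]; rewrite card_in_imset. Qed.

Lemma graph_iso_on G H : graph_iso G H <-> iso_on [set: G] [set: H].
Proof.
split=> [[f f_bij f_mono] | [f [f_inj f_im f_mono]]].
  have [g fK gK] := f_bij.
  exists f; split; [by move=> x y _ _; apply: bij_inj | | by move=> x y _ _].
  by apply/setP => z; rewrite inE -[z]gK imset_f.
exists f; last by move=> x y; rewrite f_mono.
apply: inj_card_bij => [x y|]; first exact: f_inj.
by rewrite -!cardsT -f_im leq_imset_card.
Qed.

Lemma iso_on_induced G (A : {set G}) (a : G) (aA : a \in A) :
  iso_on [set: induced aA] A.
Proof.
exists (fun x : induced aA => val x); split=> [x y _ _||//]; first exact: val_inj.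
apply/setP => z; apply/imsetP/idP => [[x _ ->]|zA]; first exact: valP x.
by exists (exist _ z zA).
Qed.

Lemma graph_iso_induced G H (A : {set G}) (B : {set H}) a b
    (aA : a \in A) (bB : b \in B) :
  graph_iso (induced aA) (induced bB) <-> iso_on A B.
Proof.
have iA := iso_on_induced aA; have iB := iso_on_induced bB.
split=> [/graph_iso_on iAB | iAB].
  exact: iso_on_trans (iso_on_trans (iso_on_sym iA) iAB) iB.
apply/graph_iso_on; exact: iso_on_trans (iso_on_trans iA iAB) (iso_on_sym iB).
Qed.

Lemma graph_iso_sym G H : graph_iso G H -> graph_iso H G.
Proof. by move=> /graph_iso_on GH; apply/graph_iso_on; exact: iso_on_sym. Qed.

Lemma graph_iso_trans G H K : graph_iso G H -> graph_iso H K -> graph_iso G K.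
Proof.
by move=> /graph_iso_on GH /graph_iso_on HK; apply/graph_iso_on/(iso_on_trans GH).
Qed.

Section Embedding.
Variables (G H : sgraph) (A : {set G}) (f : G -> H).
Hypotheses (A_cl : closed (@edge G) A) (fA_cl : closed (@edge H) (f @: A)).
Hypotheses (f_inj : {in A &, injective f}).
Hypotheses (f_mono : {in A &, {mono f : x y / edge x y}}).

Lemma component_set_sub x : x \in A -> component_set x \subset A.
Proof.
move=> xA; apply/subsetP => z; rewrite inE => xz.
by rewrite -(closed_connect A_cl xz).
Qed.

(** Each inclusion comes from a closed set containing the starting vertex: the points of [A] sent
    into the component of [f x], then the image of the component of [x]. *)
Lemma imset_component x : x \in A -> f @: component_set x = component_set (f x).
Proof.
move=> xA; have sub := subsetP (component_set_sub xA).
apply/eqP; rewrite eqEsubset; apply/andP; split; apply/subsetP => z.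
  case/imsetP => y; have cl : closed (@edge G) [pred w in A | f w \in component_set (f x)].
    apply: intro_closed => [|a b ab /andP[aA fa]].
      exact/sym_connect_sym/edge_sym.
    have bA : b \in A by rewrite -(A_cl ab).
    by rewrite inE bA -(component_closed (f x) (_ : edge (f a) (f b))) // f_mono.
  rewrite inE => /(closed_connect cl).
  by rewrite !inE xA connect0 => /esym/andP[_ fy] ->.
have cl : closed (@edge H) (f @: component_set x).
  apply: intro_closed => [|a b ab /imsetP[c cx a_def]].
    exact/sym_connect_sym/edge_sym.
  have : b \in f @: A by rewrite -(fA_cl ab) a_def imset_f ?sub.
  case/imsetP => d dA b_def; rewrite b_def imset_f //.
  rewrite -(component_closed x (_ : edge c d)) //.
  by rewrite -f_mono ?(sub c) // -a_def -b_def.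
by rewrite inE => /(closed_connect cl) <-; rewrite imset_f ?mem_component.
Qed.

Lemma iso_on_component x : x \in A -> iso_on (component_set x) (component_set (f x)).
Proof.
move=> xA; have sub := subsetP (component_set_sub xA); exists f; split.
- by move=> a b /sub aA /sub bA; apply: f_inj.
- exact: imset_component.
- by move=> a b /sub aA /sub bA; rewrite f_mono.
Qed.

End Embedding.
End IsoOn.

(** * Rigid graphs *)

(** Counting vertices instead of components avoids quotients; the two counts differ by the factor
    [#|component_set x|]. *)
Definition component_type (G H : sgraph) (x : G) : {set H} :=
  [set y | `[< iso_on (component_set x) (component_set y) >]].

Lemma component_typeP (G H : sgraph) (x : G) (y : H) :
  reflect (iso_on (component_set x) (component_set y)) (y \in component_type H x).
Proof. by rewrite inE; apply: asboolP. Qed.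

(** * Reconstruction of a graph from its component types *)

Section ComponentTypes.
Local Open Scope nat_scope.
Implicit Types G H : sgraph.

Lemma component_closedU G (A : {set G}) x :
  closed (@edge G) A -> closed (@edge G) (A :|: component_set x).
Proof.
by move=> Acl a b ab; rewrite !in_setU (Acl a b ab) (component_closed x ab).
Qed.

Lemma component_set_disj G (A : {set G}) x z :
  closed (@edge G) A -> x \notin A -> z \in component_set x -> z \notin A.
Proof. by move=> Acl xA; rewrite inE => /(closed_connect Acl) <-. Qed.

(** Induction on the number of vertices outside [A]. As [f] preserves component types and the counts
    agree in [G] and [H], a vertex outside [A] has a counterpart of the same type outside [f @: A];
    [f] is then extended by an isomorphism between their components. *)
Lemma graph_iso_extend G H (A : {set G}) (f : G -> H) :
  #|G| = #|H| ->
  (forall x : G, #|component_type G x| = #|component_type H x|) ->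
  closed (@edge G) A -> closed (@edge H) (f @: A) ->
  {in A &, injective f} -> {in A &, {mono f : x y / edge x y}} ->
  graph_iso G H.
Proof.
move=> cardGH types.
have [n] := ubnP #|~: A|; elim: n => // n IHn in A f *; rewrite ltnS => An.
move=> Acl fAcl f_inj f_mono.
have [AT|] := eqVneq A setT.
  apply/graph_iso_on; exists f; subst A; split=> //.
  by apply/eqP; rewrite eqEcard subsetT card_in_imset // !cardsT cardGH leqnn.
rewrite -properT => /properP[_ [x0 _ x0A]].
have card_in : #|component_type G x0 :&: A| = #|component_type H x0 :&: f @: A|.
  rewrite -(card_in_imset (f := f)); last first.
    by move=> a b /setIP[_ aA] /setIP[_ bA]; apply: f_inj.
  apply: eq_card => y; apply/imsetP/setIP => [[a /setIP[/component_typeP xa aA] ->]|].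
    split; last exact: imset_f.
    apply/component_typeP; apply: iso_on_trans xa _.
    exact: (iso_on_component Acl).
  move=> [/component_typeP xy /imsetP[a aA y_def]]; exists a => //; rewrite inE aA andbT.
  apply/component_typeP; apply: iso_on_trans xy _.
  by apply: iso_on_sym; rewrite y_def; exact: (iso_on_component Acl).
have : 0 < #|component_type H x0 :\: f @: A|.
  rewrite cardsD -card_in -types -cardsD; apply/card_gt0P; exists x0.
  rewrite in_setD x0A; apply/component_typeP.
  by exists id; split=> //; rewrite imset_id.
case/card_gt0P => y0 /setDP[/component_typeP[g [g_inj g_im g_mono]] y0fA].
pose f' z := if z \in A then f z else g z.
have gB z : z \in component_set x0 -> g z \in component_set y0.
  by move=> zx0; rewrite -g_im imset_f.
have f'A z : z \in A -> f' z = f z by rewrite /f' => ->.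
have f'C z : z \in component_set x0 -> f' z = g z.
  by move=> zx0; rewrite /f' (negPf (component_set_disj Acl x0A zx0)).
have f'im : f' @: (A :|: component_set x0) = f @: A :|: component_set y0.
  by rewrite imsetU (eq_in_imset f'A) (eq_in_imset f'C) g_im.
have fg a b : a \in A -> b \in component_set x0 -> f a != g b.
  move=> aA /gB gb; apply: contraNneq (component_set_disj fAcl y0fA gb) => <-.
  exact: imset_f.
(* Both sides are false: the old and new pieces lie in disjoint closed sets, in [G] as in [H]. *)
have fg_edge a b : a \in A -> b \in component_set x0 -> edge (f a) (g b) = edge a b.
  move=> aA bx0; transitivity false; last apply/esym; apply/negP.
    move/fAcl; rewrite imset_f // => /esym.
    by rewrite (negPf (component_set_disj fAcl y0fA (gB _ bx0))).
  by move/Acl; rewrite aA (negPf (component_set_disj Acl x0A bx0)).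
apply: (IHn (A :|: component_set x0) f').
- apply: leq_trans An; apply: proper_card; rewrite properE setCS subsetUl.
  by apply/subsetPn; exists x0; rewrite !in_setC // in_setU mem_component orbT.
- exact: component_closedU.
- by rewrite f'im; exact: component_closedU.
- move=> a b /setUP[aA|aC] /setUP[bA|bC].
  + by rewrite !f'A //; exact: f_inj.
  + by rewrite (f'A a) // (f'C b) // => /eqP; rewrite (negPf (fg _ _ aA bC)).
  + by rewrite (f'C a) // (f'A b) // => /esym/eqP; rewrite (negPf (fg _ _ bA aC)).
  + by rewrite !f'C //; exact: g_inj.
- move=> a b /setUP[aA|aC] /setUP[bA|bC].
  + by rewrite !f'A //; exact: f_mono.
  + by rewrite (f'A a) // (f'C b) //; exact: fg_edge.
  + by rewrite (f'C a) // (f'A b) // edge_sym fg_edge // edge_sym.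
  + by rewrite !f'C //; exact: g_mono.
Qed.

Lemma graph_iso_component_types G H :
  #|G| = #|H| ->
  (forall x : G, #|component_type G x| = #|component_type H x|) -> graph_iso G H.
Proof.
move=> cardGH types; have /card_gt0P[y0 _] := vertex_gt0 H.
(* The constant map is an arbitrary carrier for the empty partial isomorphism. *)
apply: (graph_iso_extend (A := set0) (f := fun=> y0) cardGH types).
- by move=> x y _; rewrite !inE.
- by move=> x y _; rewrite imset0 !inE.
- by move=> x y; rewrite inE.
- by move=> x y; rewrite inE.
Qed.

End ComponentTypes.

Section Rigid.
Variable R : realType.
Implicit Types G H K L : sgraph.

Definition rigid G := forall H, quantum_iso R G H -> graph_iso G H.

Lemma quantum_iso_graph_iso G G' H :
  graph_iso G G' -> quantum_iso R G' H -> quantum_iso R G H.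
Proof.
move=> [f f_bij f_mono] /quantum_isoP[X [u [proj row col inter]]].
apply/quantum_isoP; exists X, (fun x y => u x (f y)); split=> //.
- by move=> x; rewrite -(row x) [RHS](reindex f) //; exact: onW_bij.
- move=> x y; rewrite -inter [RHS](reindex f) /=; last exact: onW_bij.
  by apply: eq_bigr => z _; rewrite f_mono.
Qed.

Lemma rigid_graph_iso G G' : graph_iso G G' -> rigid G -> rigid G'.
Proof.
move=> GG' rG H G'H; apply: graph_iso_trans (graph_iso_sym GG') _.
exact/rG/(quantum_iso_graph_iso GG').
Qed.

(** [u] vanishes between vertices of non-isomorphic components, so its block on one component type
    has all row and column sums equal to 1, which forces the block to be square. *)
Lemma rigid_of_components G : (forall x : G, rigid (component x)) -> rigid G.
Proof.
move=> rG H GH; apply: graph_iso_component_types => [|x0]; first by case: GH.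
have /quantum_isoP[X [u uP]] := GH.
have ut x y : u x y != 0 -> (y \in component_type G x0) = (x \in component_type H x0).
  move=> /(quantum_iso_component uP)/rG/graph_iso_induced yx.
  apply/component_typeP/component_typeP => [/iso_on_trans/(_ yx)//|].
  by move=> /iso_on_trans; apply; exact: iso_on_sym.
apply: (mulrn_inj (oner_neq0 X)); case: uP => _ row col _.
transitivity (\sum_(y in component_type G x0) \sum_(x in component_type H x0) u x y).
  rewrite -sumr_const; apply: eq_bigr => y yt.
  rewrite -(col y) (bigID [in component_type H x0]) /= [X in _ + X]big1 ?addr0 // => x xt.
  by apply: contraNeq xt => /ut <-.
rewrite exchange_big -sumr_const; apply: eq_bigr => x xt.
rewrite -(row x) [RHS](bigID [in component_type G x0]) /= [X in _ + X]big1 ?addr0 // => y yt.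
by apply: contraNeq yt => /ut ->.
Qed.

End Rigid.

(* The disjoint union of [K] and the subgraph of [G] induced by [B]; as [B] may be
   empty, the latter need not be an [sgraph]. *)
Section Juxtapose.
Variables (G : sgraph) (B : {set G}) (K : sgraph).

Definition juxtapose_vertex : finType := (K + {x : G | x \in B})%type.

Definition juxtapose_edge : rel juxtapose_vertex := fun u v =>
  match u, v with
  | inl x, inl y => edge x y
  | inr x, inr y => edge (val x) (val y)
  | _, _ => false
  end.

Lemma juxtapose_edge_sym : symmetric juxtapose_edge.
Proof. by case=> x [] y //=; rewrite edge_sym. Qed.

Lemma juxtapose_edge_irrefl : irreflexive juxtapose_edge.
Proof. by case=> x /=; rewrite edge_irrefl. Qed.

Lemma juxtapose_vertex_gt0 : (0 < #|juxtapose_vertex|)%N.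
Proof. by rewrite card_sum addn_gt0 vertex_gt0. Qed.

Definition juxtapose : sgraph :=
  SGraph juxtapose_edge_sym juxtapose_edge_irrefl juxtapose_vertex_gt0.

End Juxtapose.

Section JuxtaposeTheory.
Variables (R : realType) (G : sgraph).
Implicit Types (B : {set G}) (K L : sgraph).

(** The witness is block diagonal: [u] beside the identity matrix on [B]. *)
Lemma quantum_iso_juxtapose B K L :
  quantum_iso R K L -> quantum_iso R (juxtapose B K) (juxtapose B L).
Proof.
move=> /quantum_isoP[X [u [proj row col inter]]]; apply/quantum_isoP.
pose v (x : juxtapose B L) (y : juxtapose B K) : X :=
  match x, y with
  | inl x, inl y => u x y
  | inr x, inr y => (x == y)%:R
  | _, _ => 0
  end.
have projb (b : bool) : projection (b%:R : X).
  by case: b; [exact: projection1 | split; rewrite ?star0 ?mulr0].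
exists X, v; split.
- by case=> x [] y; [exact: proj | exact: (projb false) | exact: (projb false) | exact: projb].
- case=> x; rewrite big_sumType /=; first by rewrite row big1 ?addr0.
  rewrite big1 // add0r (bigD1 x) //= eqxx big1 ?addr0 // => z.
  by rewrite eq_sym => /negPf ->.
- case=> y; rewrite big_sumType /=; first by rewrite col big1 ?addr0.
  by rewrite big1 // add0r (bigD1 y) //= eqxx big1 ?addr0 // => z /negPf ->.
case=> x [] y; rewrite !big_sumType /=.
- by rewrite inter; congr (_ + _); apply: eq_bigr => z _; rewrite mul0r mulr0.
- by rewrite !big1 // => z _; rewrite ?(mulr0, mul0r).
- by rewrite !big1 // => z _; rewrite ?(mulr0, mul0r).
congr (_ + _); first by rewrite !big1 // => z _; rewrite ?(mulr0, mul0r).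
rewrite (bigD1 x) // [RHS](bigD1 y) //= !eqxx mul1r mulr1.
congr (_ + _); rewrite !big1 // => z /negPf zx.
  by rewrite zx mulr0.
by rewrite eq_sym zx mul0r.
Qed.

Lemma component_juxtapose_inl B K (k : K) :
  component_set (inl k : juxtapose B K) = inl @: component_set k.
Proof.
rewrite -(@imset_component _ _ setT (inl : K -> juxtapose B K)) //.
- by move=> a b _; rewrite !inE.
- by case=> a [] b //= _; rewrite ?imset_f // ?(introF imsetP) //; case.
Qed.

Lemma component_juxtapose_inr B K L (b : {x : G | x \in B}) :
  iso_on (component_set (inr b : juxtapose B K))
         (component_set (inr b : juxtapose B L)).
Proof.
have /card_gt0P[l0 _] := vertex_gt0 L.
pose f (x : juxtapose B K) : juxtapose B L :=
  match x with inl _ => inl l0 | inr x => inr x end.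
have cl J : closed (@edge (juxtapose B J)) [set inr x | x in {: {x : G | x \in B}}].
  by case=> x [] y //= _; rewrite ?imset_f // !(introF imsetP) //; case.
have f_comp := @iso_on_component (juxtapose B K) (juxtapose B L)
  [set inr x | x in {: {x : G | x \in B}}] f.
apply: (f_comp _ _ _ _ (inr b)).
- exact: cl.
- by rewrite -imset_comp; exact: cl.
- by move=> _ _ /imsetP[x _ ->] /imsetP[y _ ->] [->].
- by move=> _ _ /imsetP[x _ ->] /imsetP[y _ ->].
- by rewrite imset_f.
Qed.

(** Count the vertices lying in components isomorphic to [K]. The part [B] contributes equally on
    both sides and all of [K] counts, whereas [L] would contribute nothing if it were not isomorphic
    to [K]. *)
Lemma juxtapose_cancel B K L :
  #|K| = #|L| -> (forall k : K, component_set k = [set: K]) ->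
  graph_iso (juxtapose B K) (juxtapose B L) -> graph_iso K L.
Proof.
move=> cardKL Kconn KL; apply: contrapT => notKL.
pose S J : {set juxtapose B J} :=
  [set z | `[< iso_on (component_set z) [set: K] >]].
have inS J z : reflect (iso_on (component_set z) [set: K]) (z \in S J).
  by rewrite inE; apply: asboolP.
have S_inl (l : L) : (inl l \in S L) = false.
  apply/negP => /inS; rewrite component_juxtapose_inl => lK; apply: notKL.
  apply/graph_iso_on/iso_on_sym; apply: iso_on_trans (lK).
  (* A component of [L] isomorphic to [K] has as many vertices as [L], hence is all of [L]. *)
  suff <- : component_set l = [set: L].
    exists inl; split=> //; [by move=> ? ? _ _ []].
  apply/eqP; rewrite eqEcard subsetT cardsT -cardKL -cardsT.
  by rewrite -(iso_on_card lK) card_imset ?leqnn // => ? ? [].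
have S_inr b : (inr b \in S L) = (inr b \in S K).
  have bb := component_juxtapose_inr K L b.
  apply/inS/inS => [|/(iso_on_trans (iso_on_sym bb))//].
  exact: iso_on_trans.
have [f f_bij f_mono] := KL.
have S_f z : (f z \in S L) = (z \in S K).
  have zf : iso_on (component_set z) (component_set (f z)).
    apply: (@iso_on_component _ _ setT) => //.
    - by move=> ? ? _; rewrite !inE.
    - have [g fK gK] := f_bij.
      by move=> a b _; rewrite -[a]gK -[b]gK !imset_f.
    - by move=> ? ? _ _; apply: bij_inj.
  by apply/inS/inS => [/(iso_on_trans zf)//|]; exact/iso_on_trans/iso_on_sym.
have : (#|S L| < #|S K|)%N.
  have /card_gt0P[k0 _] := vertex_gt0 K.
  pose h (x : juxtapose B L) : juxtapose B K :=
    match x with inl _ => inl k0 | inr x => inr x end.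
  rewrite -(card_in_imset (f := h)).
    apply: proper_card; apply/properP; split.
      by apply/subsetP => _ /imsetP[[l|b] bS ->]; [rewrite S_inl in bS | rewrite -S_inr].
    exists (inl k0); last by apply/imsetP => -[[l|b]]; rewrite ?S_inl.
    apply/inS/iso_on_sym; rewrite component_juxtapose_inl Kconn.
    by exists inl; split=> // ? ? _ _ [].
  by move=> [l|b] [l'|b']; rewrite ?S_inl // => _ _ [->].
rewrite -(card_imset (mem (S K)) (bij_inj f_bij)).
suff -> : f @: S K = S L by rewrite ltnn.
have [g fK gK] := f_bij.
by apply/setP => z; rewrite -[z]gK mem_imset ?S_f //; exact: bij_inj.
Qed.

Lemma graph_iso_juxtapose (A : {set G}) (a : G) (aA : a \in A) :
  closed (@edge G) A -> graph_iso (juxtapose (~: A) (induced aA)) G.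
Proof.
move=> Acl.
pose f (x : juxtapose (~: A) (induced aA)) : G :=
  match x with inl x => val x | inr x => val x end.
have valC (x : {x | x \in ~: A}) : val x \in A = false.
  by apply/negbTE; rewrite -in_setC (valP x).
exists f.
  apply: inj_card_bij => [|/=].
    case=> x [] y /= xy.
    - by congr inl; apply: val_inj.
    - by have := valP x; rewrite /= xy valC.
    - by have := valP y; rewrite /= -xy valC.
    - by congr inr; apply: val_inj.
  by rewrite card_sum !card_sig cardsC.
case=> x [] y //=; apply/negP => /Acl.
- by rewrite (valP x) valC.
- by rewrite (valP y) valC.
Qed.

(** Replacing the component by [L] inside [G] gives a graph quantum isomorphic to [G], hence
    isomorphic to it; the rest of [G] then cancels because a component is connected. *)
Lemma rigid_component (x : G) : rigid R G -> rigid R (component x).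
Proof.
move=> rG L xL.
have GE := graph_iso_juxtapose (mem_component x) (@component_closed G x).
apply: (@juxtapose_cancel (~: component_set x)).
- by case: xL.
- move=> k; apply/setP => z; rewrite [RHS]inE -(mem_imset _ _ val_inj).
  have val_im : val @: [set: component x] = component_set x.
    apply/setP => y; apply/imsetP/idP => [[w _ ->]|yx]; first exact: valP w.
    by exists (exist _ y yx).
  rewrite (@imset_component (component x) G setT val) ?val_im ?in_setT //.
  + have := valP z; have := valP k; rewrite !inE => xk <-.
    by rewrite (same_connect (sym_connect_sym (@edge_sym G)) xk).
  + by move=> a b _; rewrite !inE.
  + exact: component_closed.
apply: graph_iso_trans (GE) _.
exact/rG/(quantum_iso_graph_iso (graph_iso_sym GE))/quantum_iso_juxtapose.
Qed.

End JuxtaposeTheory.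

(** * Complements and disjoint unions *)

Section Operations.
Variable R : realType.

Lemma complE (G : sgraph) (X : cstarAlgType R) (x y : G) :
  (edge x y)%:R = 1 - (x == y)%:R - (@edge (compl G) x y)%:R :> X.
Proof.
rewrite /= /compl_edge; case: eqVneq => [->|_] /=.
  by rewrite edge_irrefl subrr subr0.
by case: edge; rewrite !subr0 ?subrr.
Qed.

(** The adjacency matrix of a complement is $J - I - \mathrm{Adj}$, and row and column sums equal to
    1 make [u] intertwine the all-ones matrices $J$. Hence the same [u] relates [G] to the
    complement of [H]. *)
Lemma rigid_compl (G : sgraph) : rigid R G -> rigid R (compl G).
Proof.
move=> rG H /quantum_isoP[X [u [proj row col inter]]].
have [] := rG (compl H).
  apply/quantum_isoP; exists X, u; split=> // x y.
  under eq_bigr do rewrite complE 2!mulrBr mulr1.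
  rewrite !sumrB row.
  under [RHS]eq_bigr => z _.
    have -> : (@edge (compl H) x z)%:R = 1 - (x == z)%:R - (@edge H x z)%:R :> X.
      by rewrite [in RHS]complE subKr.
    rewrite 2!mulrBl mul1r; over.
  rewrite !sumrB col inter; congr (_ - _ - _).
  rewrite (bigD1 y) //= eqxx mulr1 big1 ?addr0 => [|z /negPf ->]; last exact: mulr0.
  rewrite (bigD1 x) //= eqxx mul1r big1 ?addr0 // => z.
  by rewrite eq_sym => /negPf ->; rewrite mul0r.
move=> f f_bij f_mono; exists f => // x y.
have := f_mono x y; rewrite /= /compl_edge (inj_eq (bij_inj f_bij)).
case: eqVneq => [->|_] /=; first by rewrite !edge_irrefl.
by move=> <-; rewrite negbK.
Qed.

(** A component of the union is a component of some [G i], and is rigid because [G i] is, whether or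
    not [G i] is connected. *)
Lemma rigid_dunion n (G : 'I_n.+1 -> sgraph) :
  (forall i, rigid R (G i)) -> rigid R (dunion G).
Proof.
move=> rG; apply: rigid_of_components => -[i x].
apply: rigid_graph_iso (rigid_component (x := x) (rG i)); apply/graph_iso_induced.
pose f : G i -> dunion G := Tagged (fun i => vertex (G i)).
apply: (@iso_on_component _ _ setT f); rewrite ?in_setT //.
- by move=> a b _; rewrite !inE.
- move=> [j a] [k b] /andP[/eqP /= jk _]; subst k.
  have [ij|ij] := eqVneq j i; first by subst j; rewrite !imset_f.
  by rewrite !(introF imsetP) // => -[c _ /(congr1 tag) /= /eqP]; rewrite (negPf ij).
- by move=> a b _ _ /eqP; rewrite eq_Tagged => /eqP.
- by move=> a b _ _; rewrite /= /dunion_edge /= eqxx tagged_asE.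
Qed.

End Operations.

Theorem theorem5p16 (R : realType) (F : graph_class) :
  superrigid R F -> superrigid R (co F).
Proof.
move=> rF G H coG; move: H; elim: coG => {G}.
- by move=> G FG H; apply: rF.
- by move=> G _; apply: rigid_compl.
- by move=> n G _; apply: rigid_dunion.
- by move=> G H GH _; apply: rigid_graph_iso.
Qed.
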